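(* Assume that $\mathcal G$ is an oriented metric graph such that the function $\mathrm K$ is positive on $\mathcal V$. Then the isoperimetric constant of $\mathcal G$ satisfies $$\alpha(\mathcal G)\ \ge\ \mathrm K(\mathcal G):=\inf_{v\in\mathcal V}\mathrm K(v)\ \ge\ 0 .$$
   Context: Setting. $\mathcal G_d=(\mathcal V,\mathcal E)$ is a connected, locally finite, simple graph with countably infinite $\mathcal V$ and $\mathcal E$. Each edge $e$ has a length $|e|\in(0,\infty)$; $\mathcal G=(\mathcal V,\mathcal E,|\cdot|)$ is the metric graph. $\deg_{\mathcal G}(v)$ is the number of edges incident to $v$. Standing assumptions: $\sup_{e}|e|<\infty$ and $\deg_{\mathcal G}(v)\ne2$ for all $v$. The degree-one vertices are partitioned into $\mathcal V_D$ (Dirichlet) and $\mathcal V_N$ (Neumann), either possibly empty. Oriented means that each edge is assigned a direction; $\mathcal E_v^+$ and $\mathcal E_v^-$ are the sets of outgoing and incoming edges at $v$. The function $\mathrm K:\mathcal V\to\mathbb R\cup\{-\infty\}$ is $$\mathrm K(v)=\frac{\#(\mathcal E_v^+)-\#(\mathcal E_v^-)}{\#(\mathcal E_v^+)}\ \inf_{e\in\mathcal E_v^+}\frac1{|e|},$$ with $\mathrm K(v)=-\infty$ if $\mathcal E_v^+=\varnothing$. Isoperimetric constant. $\mathcal K_{\mathcal G}$ is the set of finite connected subgraphs (with at least one edge). For $\widetilde{\mathcal G}=(\widetilde{\mathcal V},\widetilde{\mathcal E})\in\mathcal K_{\mathcal G}$: $\mathrm{mes}(\widetilde{\mathcal G})=\sum_{e\in\widetilde{\mathcal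 E}}|e|$, $\partial_{\mathcal G}\widetilde{\mathcal G}=\{v\in\widetilde{\mathcal V}: v\in\mathcal V_D\text{ or }\deg_{\widetilde{\mathcal G}}(v)<\deg_{\mathcal G}(v)\}$, $\deg(\partial_{\mathcal G}\widetilde{\mathcal G})=\sum_{v\in\partial_{\mathcal G}\widetilde{\mathcal G}}\deg_{\widetilde{\mathcal G}}(v)$, and $\alpha(\mathcal G)=\inf_{\widetilde{\mathcal G}\in\mathcal K_{\mathcal G}}\deg(\partial_{\mathcal G}\widetilde{\mathcal G})/\mathrm{mes}(\widetilde{\mathcal G})$. *)

(* Defs.v *)
From mathcomp Require Import all_boot all_order all_algebra finmap.
From mathcomp Require Import all_classical all_reals ereal.
Set Implicit Arguments.
Unset Strict Implicit.
Unset Printing Implicit Defensive.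
Import Order.TTheory GRing.Theory Num.Theory.
Local Open Scope classical_set_scope.
Local Open Scope card_scope.
Local Open Scope fset_scope.
Local Open Scope ring_scope.

(* An edge of a simple graph is the two-element set of its endpoints; hence
   there are no loops and no multiple edges. *)

Definition incident (V : choiceType) (E : set {fset V}) (v : V) :
  set {fset V} := [set e | E e /\ v \in e].

(* Any two vertices of [W] are joined by a walk along edges of [E]. When the
   edges of [E] have their endpoints in [W], the walk stays in [W]. *)
Definition connected_graph (V : choiceType) (W : set V) (E : set {fset V}) :=
  forall u v : V, W u -> W v ->
    exists p : seq V, path (fun x y => [fset x; y] \in E) u p /\ last u p = v.

(* Every element of [V] is a vertex. Values of [len] outside of [edges] are
   irrelevant. *)
Record metric_graph (R : realType) (V : choiceType) := MetricGraph {
  edges : set {fset V} ;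
  len : {fset V} -> R ;
  edge_card2 : forall e, edges e -> #|` e| = 2%N ;
  len_gt0 : forall e, edges e -> 0 < len e ;
  vert_countably_infinite : [set: V] #= [set: nat] ;
  edges_countably_infinite : edges #= [set: nat] ;
  locally_finite : forall v, finite_set (incident edges v) ;
  graph_connected : connected_graph [set: V] edges
}.

Section Graph.
Context (R : realType) (V : choiceType) (G : metric_graph R V).

Definition deg (v : V) : nat := #|` fset_set (incident (edges G) v)|.

Definition standing_assumptions : Prop :=
  (ereal_sup [set (len G e)%:E | e in edges G] < +oo)%E /\
  (forall v, deg v <> 2%N).

Definition vertex_conditions (VD VN : set V) : Prop :=
  (VD `|` VN)%classic = [set v | deg v = 1%N] /\
  (VD `&` VN)%classic = set0.

(* Each edge is directed from [src e] to [tgt e]. *)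
Record orientation := Orientation {
  src : {fset V} -> V ;
  tgt : {fset V} -> V ;
  src_tgtE : forall e, edges G e -> e = [fset src e; tgt e]
}.

Definition out_edges (o : orientation) (v : V) : set {fset V} :=
  [set e | edges G e /\ src o e = v].

Definition in_edges (o : orientation) (v : V) : set {fset V} :=
  [set e | edges G e /\ tgt o e = v].

Definition K (o : orientation) (v : V) : \bar R :=
  let nout : R := #|` fset_set (out_edges o v)|%:R in
  let nin : R := #|` fset_set (in_edges o v)|%:R in
  if out_edges o v == set0 then -oo%E
  else (((nout - nin) / nout)%:E *
        ereal_inf [set ((len G e)^-1)%:E | e in out_edges o v])%E.

Definition K_inf (o : orientation) : \bar R := ereal_inf (range (K o)).

Definition fin_conn_subgraph (H : {fset V} * {fset {fset V}}) : Prop :=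
  [/\ forall e, e \in H.2 -> edges G e /\ e `<=` H.1,
      H.2 != fset0 &
      connected_graph [set` H.1] [set` H.2]].

Definition mes (H : {fset V} * {fset {fset V}}) : R :=
  \sum_(e <- H.2) len G e.

Definition subdeg (H : {fset V} * {fset {fset V}}) (v : V) : nat :=
  #|` [fset e in H.2 | v \in e]|.

Definition boundary (VD : set V) (H : {fset V} * {fset {fset V}}) : {fset V} :=
  [fset v in H.1 | (v \in VD) || (subdeg H v < deg v)%N].

Definition deg_boundary (VD : set V) (H : {fset V} * {fset {fset V}}) : nat :=
  (\sum_(v <- boundary VD H) subdeg H v)%N.

Definition isoperimetric_constant (VD : set V) : \bar R :=
  ereal_inf [set ((deg_boundary VD H)%:R / mes H)%:E
            | H in [set H | fin_conn_subgraph H]].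

End Graph.

(* Main.v *)
(** Weigh each edge of a finite subgraph [H] through its source. If [v] is the
    source of [e] then [K(G) |e| <= (out(v) - in(v)) / out(v) <= 1]. Summing over
    the edges of [H] issuing from [v] gives at most [out_H(v) - in_H(v)] when [v]
    is interior, since [H] then contains all the edges at [v], and at most
    [out_H(v)] when [v] is on the boundary. The differences [out_H - in_H] sum to
    [0] over the vertices of [H], so [K(G) mes(H)] is at most the number of edges
    of [H] entering boundary vertices. *)

Require Import Defs.
From mathcomp Require Import all_boot all_order all_algebra finmap.
From mathcomp Require Import all_classical all_reals ereal.

Set Implicit Arguments.
Unset Strict Implicit.
Unset Printing Implicit Defensive.
Import Order.TTheory GRing.Theory Num.Theory.
Local Open Scope fset_scope.
Local Open Scope ring_scope.

(** Serves to regroup sums over the edges of a subgraph by source or by target. *)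
Lemma big_fset_fiber (I J : choiceType) (S : nmodType) (A : {fset I})
    (B : {fset J}) (f : I -> J) (F : I -> S) :
  (forall i, i \in A -> f i \in B) ->
  \sum_(i <- A) F i = \sum_(j <- B) \sum_(i <- A | f i == j) F i.
Proof.
move=> fAB; rewrite (exchange_big_dep predT) //= big_seq [RHS]big_seq.
apply: eq_bigr => i iA.
under eq_bigl => j do rewrite eq_sym.
by rewrite -big_filter filter_pred1_uniq ?fset_uniq ?fAB// big_seq1.
Qed.

Lemma sum_fset_cond_const (I : choiceType) (S : nmodType) (A : {fset I})
    (P : pred I) (c : S) :
  \sum_(i <- A | P i) c = c *+ #|` [fset i in A | P i]|.
Proof.
rewrite big_fset_condE big_const_seq count_predT.
by rewrite iter_addr addr0.
Qed.

Section Orientation.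
Context (R : realType) (V : choiceType) (G : metric_graph R V).
Variable o : orientation G.

(** The first factor of [K], kept real-valued so that it can be summed over edges; where no edge
    leaves [v] it is [0], since [0^-1 = 0]. *)
Definition divergence_ratio (v : V) : R :=
  let nout : R := #|` fset_set (out_edges o v)|%:R in
  let nin : R := #|` fset_set (in_edges o v)|%:R in
  (nout - nin) / nout.

Lemma divergence_ratio_le1 v : divergence_ratio v <= 1.
Proof.
rewrite /divergence_ratio; set m := #|` fset_set (out_edges o v)|.
have [->|m0] := posnP m; first by rewrite invr0 mulr0.
by rewrite ler_pdivrMr ?ltr0n// mul1r gerBl.
Qed.

Lemma src_in e : edges G e -> src o e \in e.
Proof. by move=> Ge; rewrite {2}(src_tgtE o Ge) !inE eqxx. Qed.

Lemma tgt_in e : edges G e -> tgt o e \in e.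
Proof. by move=> Ge; rewrite {2}(src_tgtE o Ge) !inE eqxx orbT. Qed.

Lemma finite_out_edges v : finite_set (out_edges o v).
Proof.
apply: sub_finite_set (locally_finite G v) => e [Ge <-].
by split=> //; exact: src_in.
Qed.

Lemma finite_in_edges v : finite_set (in_edges o v).
Proof.
apply: sub_finite_set (locally_finite G v) => e [Ge <-].
by split=> //; exact: tgt_in.
Qed.

(** The edge [e] leaves its own source, so the infimum in [K] is at most [(len G e)^-1]. Multiplying
    this by the ratio preserves the inequality only if the ratio is nonnegative, which positivity of
    [K] supplies. *)
Lemma K_le_divergence_ratio e : edges G e -> (0 < K o (src o e))%E ->
  (K o (src o e) <= (divergence_ratio (src o e) / len G e)%:E)%E.
Proof.
move=> Ge; rewrite /K; case: ifPn => [//|_].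
rewrite -/(divergence_ratio (src o e)); set c := divergence_ratio _.
set i := ereal_inf _ => ci_gt0.
have i_ge0 : (0 <= i)%E.
  apply/ereal_infP => _ [f [Gf _] <-].
  by rewrite lee_fin invr_ge0 ltW// len_gt0.
have c_ge0 : 0 <= c.
  (* A negative ratio times the nonnegative infimum could not be positive. *)
  rewrite leNgt; apply/negP => c_lt0; move: ci_gt0.
  by rewrite ltNge mule_le0_ge0// lee_fin ltW.
by rewrite [leRHS]EFinM lee_wpmul2l ?lee_fin//; apply: ereal_inf_lbound; exists e.
Qed.

Lemma K_inf_ge0 : (forall v, 0 < K o v)%E -> (0 <= K_inf o)%E.
Proof. by move=> hK; apply/ereal_infP => _ [v _ <-]; exact: ltW. Qed.

Lemma K_inf_le_divergence_ratio e : (forall v, 0 < K o v)%E -> edges G e ->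
  (K_inf o <= (divergence_ratio (src o e) / len G e)%:E)%E.
Proof.
move=> hK Ge; apply: le_trans (K_le_divergence_ratio Ge (hK _)).
by apply: ereal_inf_lbound; exists (src o e).
Qed.

Section Subgraph.
Variable H : {fset V} * {fset {fset V}}.
Hypothesis HE : forall e, e \in H.2 -> edges G e /\ e `<=` H.1.

Let Hout v : {fset {fset V}} := [fset e in H.2 | src o e == v].
Let Hin v : {fset {fset V}} := [fset e in H.2 | tgt o e == v].

Lemma src_sub e : e \in H.2 -> src o e \in H.1.
Proof. by move=> /HE[Ge /fsubsetP]; apply; exact: src_in. Qed.

Lemma tgt_sub e : e \in H.2 -> tgt o e \in H.1.
Proof. by move=> /HE[Ge /fsubsetP]; apply; exact: tgt_in. Qed.

Lemma card_Hin_le v : (#|` Hin v| <= subdeg H v)%N.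
Proof.
apply/fsubset_leq_card/fsubsetP => e; rewrite !inE /= => /andP[eH /eqP <-].
by rewrite eH tgt_in//; case: (HE eH).
Qed.

(** Both sides count the edges of [H]: each has exactly one source and one target, both in [H.1]. *)
Lemma sum_Hout_Hin :
  \sum_(v <- H.1) #|` Hout v|%:R = \sum_(v <- H.1) #|` Hin v|%:R :> R.
Proof.
have E f : (forall e, e \in H.2 -> f e \in H.1) ->
    \sum_(v <- H.1) #|` [fset e in H.2 | f e == v]|%:R = \sum_(e <- H.2) 1 :> R.
  move=> fH; rewrite (big_fset_fiber _ fH); apply: eq_bigr => v _.
  by rewrite sum_fset_cond_const.
by rewrite /Hout /Hin !E//; [exact: tgt_sub|exact: src_sub].
Qed.

(** The edges of [H] at [v] lie in the finite set of edges of [G] at [v]; by the degree hypothesis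
    they are at least as many, so the two sets coincide. *)
Lemma interior_edges v e : (deg G v <= subdeg H v)%N ->
  edges G e -> v \in e -> e \in H.2.
Proof.
rewrite /deg /subdeg => degv Ge ve.
have sub : [fset e in H.2 | v \in e] `<=` fset_set (incident (edges G) v).
  apply/fsubsetP => f; rewrite !inE /= => /andP[fH vf].
  rewrite in_fset_set; last exact: locally_finite.
  by rewrite inE; split=> //; case: (HE fH).
have /eqP eqE : [fset e in H.2 | v \in e] == fset_set (incident (edges G) v).
  by rewrite eqEfcard sub.
have : e \in fset_set (incident (edges G) v).
  by rewrite in_fset_set ?inE//; exact: locally_finite.
by rewrite -eqE !inE => /andP[].
Qed.

(** Lets the denominator of [divergence_ratio v] cancel against the number of edges of [H] leaving
    [v]. *)
Lemma Hout_interior v : (deg G v <= subdeg H v)%N ->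
  Hout v = fset_set (out_edges o v).
Proof.
move=> degv; apply/fsetP => e.
rewrite in_fset_set; last exact: finite_out_edges.
rewrite !inE /=; apply/andP/idP => [[eH /eqP ev]|].
  by rewrite inE; split=> //; case: (HE eH).
rewrite inE => -[Ge ev]; split; last by rewrite ev.
by apply: (interior_edges degv) => //; rewrite -ev src_in.
Qed.

Lemma Hin_interior v : (deg G v <= subdeg H v)%N ->
  Hin v = fset_set (in_edges o v).
Proof.
move=> degv; apply/fsetP => e.
rewrite in_fset_set; last exact: finite_in_edges.
rewrite !inE /=; apply/andP/idP => [[eH /eqP ev]|].
  by rewrite inE; split=> //; case: (HE eH).
rewrite inE => -[Ge ev]; split; last by rewrite ev.
by apply: (interior_edges degv) => //; rewrite -ev tgt_in.
Qed.

Lemma sum_divergence_ratio_le (VD : set V) (hK : forall v, (0 < K o v)%E) :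
  \sum_(e <- H.2) divergence_ratio (src o e) <= (deg_boundary G VD H)%:R.
Proof.
pose bd v := (v \in VD) || (subdeg H v < deg G v)%N.
rewrite (big_fset_fiber _ src_sub).
(* Incoming edges are subtracted at interior vertices only; on the boundary the ratio is merely
   bounded by [1]. *)
apply: (@le_trans _ _ (\sum_(v <- H.1) (#|` Hout v|%:R -
    (if bd v then 0 else #|` Hin v|%:R)))).
  apply: ler_sum => v _.
  rewrite (eq_bigr (fun=> divergence_ratio v)); last by move=> e /eqP ->.
  rewrite sum_fset_cond_const -/(Hout v) -[leLHS]mulr_natr.
  case: ifPn => [_|]; first by rewrite subr0 ler_piMl// divergence_ratio_le1.
  rewrite /bd negb_or -leqNgt => /andP[_ degv].
  rewrite Hout_interior// Hin_interior// divfK// pnatr_eq0 cardfs_eq0.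
  (* With no outgoing edge, [K o v] would be [-oo], against positivity. *)
  apply/negP => /eqP out0; have := hK v; rewrite /K.
  suff -> : out_edges o v = set0 by rewrite eqxx.
  by rewrite -(fset_setK (finite_out_edges v)) out0 set_fset0.
rewrite big_split /= sum_Hout_Hin -big_split /=.
rewrite /deg_boundary /boundary -big_fset_condE natr_sum big_mkcond [leRHS]big_mkcond.
apply: ler_sum => v _; rewrite -/(bd v); case: ifP => _.
  by rewrite subr0 ler_nat card_Hin_le.
by rewrite subrr.
Qed.

End Subgraph.
End Orientation.

Lemma mes_gt0 (R : realType) (V : choiceType) (G : metric_graph R V)
    (H : {fset V} * {fset {fset V}}) :
  (forall e, e \in H.2 -> edges G e) -> H.2 != fset0 -> 0 < mes G H.
Proof.
move=> HE /fset0Pn[e eH]; rewrite /mes (big_fsetD1 e)//=.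
apply: ltr_wpDr; last exact/len_gt0/HE.
rewrite big_seq; apply: sumr_ge0 => f; rewrite !inE => /andP[_ fH].
exact/ltW/len_gt0/HE.
Qed.

Theorem lemma6p1 (R : realType) (V : choiceType) (G : metric_graph R V)
    (VD VN : set V) (o : orientation G)
    (hG : standing_assumptions G)
    (hDN : vertex_conditions G VD VN)
    (hK : forall v : V, (0 < K o v)%E) :
  (K_inf o <= isoperimetric_constant G VD)%E /\ (0 <= K_inf o)%E.
Proof.
split; last exact: K_inf_ge0.
apply/ereal_infP => _ [H [HE H0 _] <-].
have GE e : e \in H.2 -> edges G e by case/HE.
(* Any edge of [H] bounds [K_inf o] above by a real number; with the lower bound [0] this makes it a
   real [k]. *)
have [e eH] := fset0Pn _ H0.
have := K_inf_ge0 hK; have := K_inf_le_divergence_ratio hK (GE _ eH).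
have Kle f := @K_inf_le_divergence_ratio _ _ _ o f hK.
case: (K_inf o) Kle => [k| |]// Kle _ _.
rewrite lee_fin ler_pdivlMr; last exact: mes_gt0.
apply: le_trans (sum_divergence_ratio_le HE VD hK).
(* Edge by edge, [k * len G f] is at most the ratio at the source of [f]. *)
rewrite /mes mulr_sumr big_seq [leRHS]big_seq; apply: ler_sum => f /GE Gf.
by rewrite -ler_pdivlMr ?len_gt0// -lee_fin Kle.
Qed.
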